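(* Let $E$ and $F$ be nonempty convex sets in $\mathbb{R}^n$. The following assertions are equivalent. (a) Every vector $u \in \mathbb{R}^n$ is uniquely expressible as $u = y + z$, where $y \in E$ and $z \in F$; that is, for every $u\in\mathbb{R}^n$ there is exactly one pair $(y,z)\in E\times F$ with $u=y+z$. (b) $E$ and $F$ are complementary planes.
   Context: A plane (affine subspace) in $\mathbb{R}^n$ is a translate $c+S$ of a linear subspace $S\subseteq\mathbb{R}^n$, of any dimension $m$ with $0\leqslant m\leqslant n$. Planes $L_1$ and $L_2$ in $\mathbb{R}^n$ are complementary if $L_1=c_1+S_1$ and $L_2=c_2+S_2$ for some vectors $c_1,c_2\in\mathbb{R}^n$ and linear subspaces $S_1,S_2$ with $S_1+S_2=\mathbb{R}^n$ and $S_1\cap S_2=\{o\}$, where $o$ is the origin. For the ordered pair $(E,F)$, expressions $u=y_1+z_1$ and $u=y_2+z_2$ with $y_i\in E$, $z_i\in F$ are considered different if and only if $y_1\neq y_2$ (equivalently $z_1\neq z_2$). *)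

(* Defs.v *)
From HB Require Import structures.
From mathcomp Require Import all_boot all_order all_algebra.
From mathcomp Require Import all_classical all_reals all_analysis.

Set Implicit Arguments.
Unset Strict Implicit.
Unset Printing Implicit Defensive.

Import Order.TTheory GRing.Theory Num.Theory.
Local Open Scope classical_set_scope.
Local Open Scope ring_scope.

Definition plane (R : realType) (n : nat) (c : 'rV[R]_n)
    (S : {vspace 'rV[R]_n}) : set 'rV[R]_n :=
  [set c + s | s in [set` S]].

Definition complementary_planes (R : realType) (n : nat)
    (L1 L2 : set 'rV[R]_n) : Prop :=
  exists (c1 c2 : 'rV[R]_n) (S1 S2 : {vspace 'rV[R]_n}),
    [/\ L1 = plane c1 S1, L2 = plane c2 S2,
        (S1 + S2)%VS = fullv & (S1 :&: S2)%VS = 0%VS].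

(* Uniqueness is that of the ordered pair (y, z), not of {y, z}. *)
Definition uniquely_expressible (R : realType) (n : nat)
    (E F : set 'rV[R]_n) (u : 'rV[R]_n) : Prop :=
  exists! yz : 'rV[R]_n * 'rV[R]_n,
    [/\ E yz.1, F yz.2 & u = yz.1 + yz.2].

(* Main.v *)
(** For a nonempty convex set [A], the differences of points of [A] generate a
    linear subspace [D(A)] simply by positive rescaling.  A vector common to
    [D(E)] and [D(F)] can be shrunk until it is a difference both of points of
    [E] and of points of [F], [e - e' = f - f']; then [e + f' = e' + f], and
    uniqueness forces it to vanish.  As [E + F] is everything, [D(E)] and
    [D(F)] are complementary.  Finally, for [c1] in [E], [c2] in [F] and [v]
    in [D(E)], write [c1 + v + c2 = y + z]: then [y - c1 - v = c2 - z] lies in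
    both directions, so [c1 + v = y] is in [E], and [E = c1 + D(E)]. *)
Require Import Defs.
From mathcomp Require Import all_boot all_order all_algebra.
From mathcomp Require Import all_classical all_reals all_analysis.
From mathcomp Require Import ring.
Import Order.TTheory GRing.Theory Num.Theory.
Local Open Scope classical_set_scope.
Local Open Scope ring_scope.

(** Among the subspaces contained in [P], one of maximal dimension exhausts [P]: adjoining the line
    through any [v] in [P] stays inside [P], so it cannot raise the dimension. *)
Lemma exists_vspace_of_submod_closed (K : fieldType) (V : vectType K)
    (P : set V) :
  P 0 -> (forall a v w, P v -> P w -> P (a *: v + w)) ->
  exists U : {vspace V}, forall v, v \in U <-> P v.
Proof.
move=> P0 Plin.
pose inP d :=
  `[< exists2 U : {vspace V}, [set` U] `<=` P & \dim U = d >].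
have exP : exists d, inP d.
  exists 0%N; apply/asboolP; exists 0%VS; last exact: dimv0.
  by move=> v /=; rewrite memv0 => /eqP ->.
have ubP d : inP d -> (d <= \dim {: V})%N.
  by move=> /asboolP[U _ <-]; exact/dimvS/subvf.
case: (ex_maxnP exP ubP) => _ /asboolP[U UP <-] Umax.
exists U => v; split=> [|Pv]; first exact: UP.
have Uv_sub : (U <= U + <[v]>)%VS by exact: addvSl.
have Uv_dim : (\dim (U + <[v]>) <= \dim U)%N.
  apply: Umax; apply/asboolP; exists (U + <[v]>)%VS => // w /=.
  move=> /memv_addP[u uU [_ /vlineP[a ->] ->]].
  by rewrite addrC; apply: Plin => //; exact: UP.
have /subvP : (U + <[v]> <= U)%VS.
  by rewrite -(geq_leqif (dimv_leqif_sup Uv_sub)).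
by apply; apply: (subvP (addvSr U <[v]>)); exact: memv_line.
Qed.

Section Direction.
Context {R : realType} {V : lmodType R}.
Implicit Types A : set V.

Definition direction A : set V :=
  [set v | exists t x y, [/\ 0 < t, A x, A y & t *: v = x - y]].

Lemma convex_set_conv {A} {t : R} {x y} : convex_set A -> 0 <= t -> t <= 1 ->
  A x -> A y -> A (t *: x + (1 - t) *: y).
Proof.
move=> Aconv t0 t1 Ax Ay.
by apply/set_mem; apply: (Aconv x y (Itv01 t0 t1)); apply/mem_set.
Qed.

Lemma direction_sub {A x y} : A x -> A y -> direction A (x - y).
Proof. by move=> Ax Ay; exists 1, x, y; rewrite scale1r. Qed.

Lemma direction_scale {A a v} : A !=set0 ->
  direction A v -> direction A (a *: v).
Proof.
move=> [c Ac] [t [x [y [t0 Ax Ay tv]]]].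
have [a0|a0|->] := ltgtP a 0.
- exists (t / - a), y, x; split=> //; first by rewrite divr_gt0// oppr_gt0.
  rewrite scalerA invrN mulrN mulNr divfK ?lt_eqF//.
  by rewrite scaleNr tv opprB.
- exists (t / a), x, y; split=> //; first exact: divr_gt0.
  by rewrite scalerA divfK ?gt_eqF.
- by rewrite scale0r -(subrr c); exact: direction_sub.
Qed.

Lemma direction_add {A v w} : convex_set A ->
  direction A v -> direction A w -> direction A (v + w).
Proof.
move=> Aconv [t [x [y [t0 Ax Ay tv]]]] [s [x' [y' [s0 Ax' Ay' sw]]]].
have st0 : 0 < s + t by exact: addr_gt0.
(* This weight solves [p * t = (1 - p) * s]: mixing the two pairs of points with weights [p] and
   [1 - p] then gives [v] and [w] the same coefficient. *)
set p := s / (s + t).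
have p0 : 0 < p by exact: divr_gt0.
have p1 : p <= 1 by rewrite ler_pdivrMr// mul1r lerDl ltW.
have pt : p * t = (1 - p) * s by rewrite /p; field; rewrite gt_eqF.
exists (p * t), (p *: x + (1 - p) *: x'), (p *: y + (1 - p) *: y'); split.
- exact: mulr_gt0.
- by apply: convex_set_conv => //; exact: ltW.
- by apply: convex_set_conv => //; exact: ltW.
- by rewrite scalerDr {2}pt -!scalerA tv sw !scalerBr opprD addrACA.
Qed.

(** Sliding [x] towards [y] along their segment shortens the difference by any factor in [0, 1]. A
    whole range of [s] is offered so that two sets can later share one scale. *)
Lemma direction_shrink {A v} : convex_set A -> direction A v ->
  exists2 t, 0 < t & forall s, 0 <= s -> s <= t ->
    exists x y, [/\ A x, A y & s *: v = x - y].
Proof.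
move=> Aconv [t [x [y [t0 Ax Ay tv]]]]; exists t => // s s0 st.
have st1 : s / t <= 1 by rewrite ler_pdivrMr// mul1r.
have st_ge0 : 0 <= s / t by rewrite divr_ge0// ltW.
exists (s / t *: x + (1 - s / t) *: y), y; split=> //.
  exact: convex_set_conv.
rewrite scalerBl scale1r addrCA addrAC subrr add0r -scalerBr -tv.
by rewrite scalerA divfK// gt_eqF.
Qed.

End Direction.

Lemma direction_vspace {R : realType} {V : vectType R} {A : set V} :
  A !=set0 -> convex_set A ->
  exists U : {vspace V}, forall v, v \in U <-> direction A v.
Proof.
move=> A0 Aconv; apply: exists_vspace_of_submod_closed.
  by case: A0 => c Ac; rewrite -(subrr c); exact: direction_sub.
by move=> a v w Av Aw; apply: direction_add => //; exact: direction_scale.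
Qed.

(** Only the first summand is treated; the second follows by exchanging the roles of the two
    sets. *)
Lemma eq_plane_of_uniquely_expressible {R : realType} {n : nat}
    {E F : set 'rV[R]_n} {U W : {vspace 'rV[R]_n}} {c1 c2 : 'rV[R]_n} :
  (forall v, v \in U <-> direction E v) ->
  (forall v, v \in W <-> direction F v) ->
  (U :&: W = 0)%VS -> (forall u, uniquely_expressible E F u) ->
  E c1 -> F c2 -> E = plane c1 U.
Proof.
move=> UE WF UW0 uEF Ec1 Fc2; apply/seteqP; split=> [x Ex|_ [v /= vU <-]].
  by exists (x - c1); [apply/UE; exact: direction_sub|rewrite subrKC].
have [[y z] [[/= Ey Fz yz] _]] := uEF (c1 + v + c2).
have d_eq : y - c1 - v = c2 - z.
  apply/eqP; rewrite -addrA -opprD subr_eq addrAC eq_sym subr_eq.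
  by rewrite -yz addrC.
have : y - c1 - v \in (U :&: W)%VS.
  apply/memv_capP; split; last by rewrite d_eq; apply/WF; exact: direction_sub.
  by rewrite memvB//; apply/UE; exact: direction_sub.
rewrite UW0 memv0 subr_eq0 => /eqP <-.
by rewrite subrKC.
Qed.

Lemma complementary_planes_of_uniquely_expressible (R : realType) (n : nat)
    (E F : set 'rV[R]_n) :
  E !=set0 -> F !=set0 -> convex_set E -> convex_set F ->
  (forall u, uniquely_expressible E F u) -> complementary_planes E F.
Proof.
move=> E0 F0 Econv Fconv uEF.
have [U UE] := direction_vspace E0 Econv.
have [W WF] := direction_vspace F0 Fconv.
(* The pairs are ordered, so the exchange of roles needs its own statement. *)
have uFE u : uniquely_expressible F E u.
  have [[y z] [[/= Ey Fz ->] yz_uniq]] := uEF u.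
  exists (z, y); split=> [|[z' y'] [/= Fz' Ey' yzE]].
    by split=> //=; rewrite addrC.
  suff [-> ->] : (y, z) = (y', z') by [].
  by apply: yz_uniq; split=> //=; rewrite yzE addrC.
have UW0 : (U :&: W = 0)%VS.
  apply/eqP; rewrite -subv0; apply/subvP => v /memv_capP[/UE Ev /WF Fv].
  have [t t0 Et] := direction_shrink Econv Ev.
  have [s s0 Fs] := direction_shrink Fconv Fv.
  (* At this common scale [r *: v] is a difference in both sets. *)
  pose r := Num.min t s.
  have r0 : 0 < r by rewrite lt_min t0.
  have [|e [e' [Ee Ee' rve]]] := Et r (ltW r0); first by rewrite ge_min lexx.
  have [|f [f' [Ff Ff' rvf]]] := Fs r (ltW r0).
    by rewrite ge_min lexx orbT.
  (* The vector [e + f'] is also [e' + f]; uniqueness gives [e = e'], hence [r *: v = 0]. *)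
  have [yz [_ yz_uniq]] := uEF (e + f').
  have yz1 : yz = (e, f') by exact: yz_uniq.
  have yz2 : yz = (e', f).
    apply: yz_uniq; split=> //=.
    by rewrite -[e](subrK e') -rve rvf addrAC subrK addrC.
  move: yz1; rewrite yz2 => -[ee' _].
  move: rve; rewrite ee' subrr => /eqP.
  by rewrite scaler_eq0 gt_eqF//= memv0.
have [c1 Ec1] := E0; have [c2 Fc2] := F0.
exists c1, c2, U, W; split=> //.
- exact: (eq_plane_of_uniquely_expressible UE WF UW0 uEF Ec1 Fc2).
- apply: (eq_plane_of_uniquely_expressible WF UE _ uFE Fc2 Ec1).
  by rewrite capvC.
- apply/eqP; rewrite eqEsubv subvf; apply/subvP => u _.
  (* The shift by the base points makes [u] the sum of [y - c1] and [z - c2]. *)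
  have [[y z] [[/= Ey Fz uE] _]] := uEF (u + (c1 + c2)).
  apply/memv_addP; exists (y - c1); first exact/UE/direction_sub.
  exists (z - c2); first exact/WF/direction_sub.
  by rewrite addrACA -opprD -uE addrK.
Qed.

Lemma uniquely_expressible_of_complementary_planes (R : realType) (n : nat)
    (E F : set 'rV[R]_n) u :
  complementary_planes E F -> uniquely_expressible E F u.
Proof.
move=> [c1 [c2 [U [W [-> -> UW_full UW0]]]]].
have : u - (c1 + c2) \in (U + W)%VS by rewrite UW_full memvf.
move=> /memv_addP[v vU [w wW uE]].
have {}uE : u = c1 + v + (c2 + w) by rewrite addrACA -uE subrKC.
exists (c1 + v, c2 + w); split; first by split=> //=; [exists v|exists w].
move=> [_ _] [/= [v' v'U <-] [w' w'W <-]]; rewrite uE addrACA [in RHS]addrACA.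
move=> /addrI vw.
(* Two expressions of [u] differ by a vector lying in both subspaces, hence by zero. *)
have vv' : v - v' = w' - w.
  by apply/eqP; rewrite subr_eq addrAC eq_sym subr_eq vw addrC.
have : v - v' \in (U :&: W)%VS.
  by apply/memv_capP; split; [|rewrite vv']; exact: memvB.
rewrite UW0 memv0 => /eqP vv'0; move: vv'; rewrite vv'0 => /esym/eqP.
by rewrite subr_eq0 => /eqP ->; move/eqP: vv'0; rewrite subr_eq0 => /eqP ->.
Qed.

Theorem theorem1p5 (R : realType) (n : nat) (E F : set 'rV[R]_n)
    (E_nonempty : E !=set0) (F_nonempty : F !=set0)
    (E_convex : convex_set E) (F_convex : convex_set F) :
  (forall u : 'rV[R]_n, uniquely_expressible E F u) <->
  complementary_planes E F.
Proof.
split; first exact: complementary_planes_of_uniquely_expressible.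
by move=> EF u; exact: uniquely_expressible_of_complementary_planes.
Qed.
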